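(* Let $\mathfrak M=(\mathcal M,\rho)$ be a pseudometric space, and let $F:\mathcal M\to\mathrm{Conv}(\mathbf R^2)$ be a set-valued mapping. Suppose that either $\mathcal M$ is finite or there exist a constant $\alpha\ge0$ and elements $\bar x_1,\dots,\bar x_m\in\mathcal M$ such that the set $\bigcap\{F(\bar x_k)+\alpha Q_0:k=1,\dots,m\}$ is non-empty and bounded. Then $F$ has a Lipschitz selection if and only if there exists a constant $\lambda\ge0$ such that $$\mathcal R_F[x,x':\lambda]\cap\{\mathcal R_F[y,y':\lambda]+\lambda\,\rho(x,y)\,Q_0\}\ne\emptyset\quad\text{for every }x,x',y,y'\in\mathcal M.$$ Furthermore, $\inf\lambda\le|F|_{\mathfrak M}\le5\inf\lambda$, where the infimum is over all such $\lambda$.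
   Context: A pseudometric space $\mathfrak M=(\mathcal M,\rho)$ is a set with $\rho:\mathcal M\times\mathcal M\to[0,+\infty]$ such that $\rho(x,x)=0$, $\rho(x,y)=\rho(y,x)$, $\rho(x,y)\le\rho(x,z)+\rho(z,y)$; $\rho(x,y)=0$ with $x\ne y$ and $\rho(x,y)=+\infty$ are allowed. We read $\lambda\cdot(+\infty)=+\infty$ for every $\lambda\ge0$ and $(+\infty)Q_0=\mathbf R^2$. $\mathbf R^2$ carries the uniform norm $\|x\|=\max\{|x_1|,|x_2|\}$; $Q_0=[-1,1]^2$; sums of sets are Minkowski sums. $\mathrm{Conv}(\mathbf R^2)$ is the family of all non-empty convex closed subsets of $\mathbf R^2$. For $f:\mathcal M\to\mathbf R^2$, $\|f\|_{\mathrm{Lip}(\mathcal M)}=\inf\{\lambda\ge0:\|f(x)-f(y)\|\le\lambda\rho(x,y)\ \forall x,y\in\mathcal M\}$ ($\inf\emptyset=+\infty$); $f$ is Lipschitz if this is finite. A selection of $F$ is a map $f:\mathcal M\to\mathbf R^2$ with $f(x)\in F(x)$ for all $x$. $|F|_{\mathfrak M}$ is the infimum of $\|f\|_{\mathrm{Lip}(\mathcal M)}$ over all Lipschitz selections $f$ of $F$, and $+\infty$ if there are none. For a convex set $S\subset\mathbf R^2$, the rectangular hull $\mathcal H[S]$ is the smallest rectangle (product of two intervals, possibly unbounded and not necessarily closed, sides parallel to the coordinate axes) containing $S$; equivalently $\mathcal H[S]$ is the product of the orthogonal projections of $S$ onto the two coordinate axes ($\mathcal H[\emptyset]=\emptyset$).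 For $x,x'\in\mathcal M$, $\lambda\ge0$, $$\mathcal R_F[x,x':\lambda]=\mathcal H[F(x)\cap\{F(x')+\lambda\,\rho(x,x')Q_0\}].$$
   Formalization: For infinite M the elements x̄_k (and α) are required to exist at finite distance from each given point of M; without this the claim fails when ρ takes the value +∞. For finite-valued ρ this is the original hypothesis. *)

(* Defs.v *)
From HB Require Import structures.
From mathcomp Require Import all_boot all_order all_algebra.
From mathcomp Require Import all_classical all_reals all_analysis.

Set Implicit Arguments.
Unset Strict Implicit.
Unset Printing Implicit Defensive.

Import Order.TTheory GRing.Theory Num.Theory.
Import numFieldNormedType.Exports.

Local Open Scope classical_set_scope.
Local Open Scope ring_scope.

Section PlaneSets.
Context {R : realType}.

(* The plane is (R * R)%type, whose library norm is max(|x.1|, |x.2|). *)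

Definition Conv : set (set (R * R)) :=
  [set A : set (R * R) | [/\ A !=set0, convex_set A & closed A]].

Definition Q0 : set (R * R) := `[-1, 1]%classic `*` `[-1, 1]%classic.

Definition minkowski_sum (A B : set (R * R)) : set (R * R) :=
  [set p.1 + p.2 | p in A `*` B].

(* l * r for l >= 0 and 0 <= r <= +oo, with l * +oo = +oo also for l = 0,
   whereas 0 * +oo = 0 for the multiplication of \bar R. *)
Definition escale (l : R) (r : \bar R) : \bar R :=
  match r with
  | s%:E => (l * s)%:E
  | +oo%E => +oo%E
  | -oo%E => -oo%E
  end.

(* The ball r Q_0; the value at -oo is never used. *)
Definition dilQ0 (r : \bar R) : set (R * R) :=
  match r with
  | s%:E => [set s *: z | z in Q0]
  | +oo%E => setT
  | -oo%E => set0
  end.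

Definition is_rectangle (A : set (R * R)) : Prop :=
  exists I J : set R, [/\ is_interval I, is_interval J & A = I `*` J].

Definition rect_hull (S : set (R * R)) : set (R * R) :=
  smallest is_rectangle S.

Lemma is_rectangle_hull (S : set (R * R)) : is_rectangle (rect_hull S).
Proof.
pose I := [set a | exists b, rect_hull S (a, b)].
pose J := [set b | exists a, rect_hull S (a, b)].
have hullP a b a' b' c d : rect_hull S (a, b') -> rect_hull S (c, d) ->
    rect_hull S (a', b) -> forall u v, (a <= u <= c \/ u = a) ->
    (b <= v <= d \/ v = b) -> rect_hull S (u, v).
  move=> h1 h2 h3 u v hu hv A /= CA.
  have := h1 A CA; have := h2 A CA; have := h3 A CA.
  have [[I0 [J0 [iI iJ ->]]] _] := CA.
  move=> [/= _ Jb] [/= Ic Jd] [/= Ia _]; split => /=.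
    by case: hu => [/iI|->//]; apply.
  by case: hv => [/iJ|->//]; apply.
exists I, J; split.
- move=> a c [b' hab'] [d hcd] u acu; exists b'.
  by apply: (hullP a b' a b' c d) => //; [left|right].
- move=> b d [a' ha'b] [c hcd] v bdv; exists a'.
  by apply: (hullP a' b a' b c d) => //; [right|left].
- apply/seteqP; split => [[a b] h|[a b] [/= [b' h] [a' h']]].
    by split; [exists b|exists a].
  by apply: (hullP a b a' b' a b') => //; right.
Qed.

Lemma rect_hullE (S : set (R * R)) : convex_set S ->
  rect_hull S = (fst @` S) `*` (snd @` S).
Proof.
move=> cS; apply/seteqP; split.
  have pr_itv (g : R * R -> R) :
      (forall (p q : R * R) (t : R),
        g (t *: p + (1 - t) *: q) = t * g p + (1 - t) * g q) ->
      is_interval (g @` S).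
    move=> glin _ _ [p Sp <-] [q Sq <-] z /andP[pz zq].
    have [pq|qp] := ltP (g p) (g q); last first.
      by exists p => //; apply/eqP; rewrite eq_le pz (le_trans zq qp).
    have d0 : 0 < g q - g p by rewrite subr_gt0.
    pose t := (g q - z) / (g q - g p).
    have t01 : 0 <= t <= 1.
      rewrite divr_ge0 ?(ltW d0) ?subr_ge0//=.
      by rewrite ler_pdivrMr// mul1r lerB.
    exists (t *: p + (1 - t) *: q); last first.
      rewrite glin; have -> : t * g p + (1 - t) * g q = g q - t * (g q - g p).
        by rewrite mulrBl mul1r mulrBr opprB addrCA.
      by rewrite divfK ?gt_eqF// opprB addrCA subrr addr0.
    have [t0 t1] := andP t01.
    have := cS p q (Itv01 t0 t1) (mem_set Sp) (mem_set Sq).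
    by rewrite inE.
  apply: smallest_sub; last by move=> p Sp; split; exists p.
  by exists (fst @` S), (snd @` S); split => //; apply: pr_itv.
move=> [a b] [/= [p Sp <-] [q Sq <-]] A [[I [J [_ _ ->]]] SA].
by split; [have [] := SA _ Sp|have [] := SA _ Sq].
Qed.

End PlaneSets.

Section Selections.
Context {R : realType} {M : Type}.
Variables (rho : M -> M -> \bar R) (F : M -> set (R * R)).

Definition pseudometric : Prop :=
  [/\ forall x y, (0 <= rho x y)%E,
      forall x, rho x x = 0%E,
      forall x y, rho x y = rho y x &
      forall x y z, (rho x y <= rho x z + rho z y)%E].

Definition lip_norm (f : M -> R * R) : \bar R :=
  ereal_inf [set l%:E | l in [set l : R | 0 <= l /\
    forall x y, (`|f x - f y|%:E <= escale l (rho x y))%E]].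

Definition selection (f : M -> R * R) : Prop := forall x, F x (f x).

Definition lipschitz_selection (f : M -> R * R) : Prop :=
  selection f /\ (lip_norm f < +oo)%E.

(* |F|_M, equal to +oo when there is no Lipschitz selection. *)
Definition selection_norm : \bar R :=
  ereal_inf [set lip_norm f | f in lipschitz_selection].

Definition rectF (l : R) (x x' : M) : set (R * R) :=
  rect_hull (F x `&` minkowski_sum (F x') (dilQ0 (escale l (rho x x')))).

Definition rect_criterion (l : R) : Prop :=
  forall x x' y y' : M,
    (rectF l x x' `&` minkowski_sum (rectF l y y') (dilQ0 (escale l (rho x y)))) !=set0.

Definition criterion_inf : \bar R :=
  ereal_inf [set l%:E | l in [set l : R | 0 <= l /\ rect_criterion l]].

End Selections.

(* Main.v *)
Require Import Defs.
From mathcomp Require Import all_boot all_order all_algebra.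
From mathcomp Require Import all_classical all_reals all_analysis.
From mathcomp Require Import ring lra.

Import Order.TTheory GRing.Theory Num.Theory.
Import numFieldNormedType.Exports.

Local Open Scope classical_set_scope.
Local Open Scope ring_scope.

(** One direction is immediate: if a selection [f] has Lipschitz constant [l],
    then [f x] belongs to every [rectF rho F l x x'], so [f x] and [f y] witness
    the criterion at [l].

    Conversely, let the criterion hold at [l] and write [d] for [l * rho].  Over
    finitely many points the selection is built in two steps.

    In the first step the rectangles are treated one coordinate at a time, where
    they are intervals at mutual distance at most [d].  In dimension one this is
    enough for a [1]-Lipschitz [g] whose coordinates lie in the projections of
    all the slices [F x `&` (F x' + d x x' Q0)] ([slice_coordinate]).  With the
    factor [3], the triangle inequality shows that the vertical line through
    [g x] meets any two of the sets [F z + 3 d x z Q0], and Helly's theorem on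
    that line gives a point common to all of them ([line_meets]); the same holds
    for the horizontal line.  Hence [g x] lies in the rectangular hull of the
    intersection [G x] of the sets [F z + 3 d x z Q0].

    In the second step [f x] is the point of [G x] nearest to [g x].  As [g x]
    is in the rectangular hull of [G x], that point is the corner
    [g x + r (sg t, sg s)] of a square of centre [g x], where [t] and [s] are
    the signed horizontal and vertical displacements from [g x] to points of
    [G x].  Moreover the radius [r] is the largest of the distances from [g x]
    to the single sets [F z + 3 d x z Q0], and not merely to their intersection
    ([axis_projection_mem]).  Therefore [r] is Lipschitz with constant
    [1 + 3 = 4].  If the signs at [x] and at [y] agree, a coordinate of [f]
    varies by at most [d x y] from [g] and [4 * d x y] from [r].  If they
    disagree, the segment between a point of [F z] near the axis at [x] and one
    near the opposite half-axis at [y] passes close to [g x] and to [g y], which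
    forces [r x + r y <= 4 * d x y] ([radius_opposite]).  This gives
    [1 + 4 = 5].

    Infinite distances are cut off at a constant exceeding all the finitely many
    distances that occur between witnesses ([finite_family_selection]).  For
    infinite [M], the selections on finite subfamilies are glued by Tychonoff's
    theorem ([selection_compactness]); the values at [z] stay in a bounded set
    because they are within a fixed distance of every [F (xbar k)], and
    enlarging the sets [F (xbar k)] keeps their intersection bounded
    ([bounded_enlargement]). *)

(** * Convex subsets of the plane with the uniform norm *)

Section Plane.
Context {R : realType}.
Implicit Types (p q c : R * R) (A : set (R * R)).

Lemma norm_pair_le p (r : R) : (`|p| <= r) = (`|p.1| <= r) && (`|p.2| <= r).
Proof. by rewrite prod_normE /= ge_max. Qed.

(** The boolean selects one of the two coordinate directions, so that statements
    about vertical and horizontal lines need only one proof. *)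
Definition coord (b : bool) p : R := if b then p.2 else p.1.

Definition point (b : bool) (h k : R) : R * R := if b then (k, h) else (h, k).

Lemma coord_comb b p q (t : R) :
  coord b (t *: p + (1 - t) *: q) = t * coord b p + (1 - t) * coord b q.
Proof. by case: b. Qed.

Lemma coordB b p q : coord b (p - q) = coord b p - coord b q.
Proof. by case: b. Qed.

Lemma coord_point b h k : coord b (point b h k) = h.
Proof. by case: b. Qed.

Lemma coordN_point b h k : coord (~~ b) (point b h k) = k.
Proof. by case: b. Qed.

Lemma point_comb b (t h k k' : R) :
  point b h (t * k + (1 - t) * k') =
  t *: point b h k + (1 - t) *: point b h k'.
Proof.
by case: b; congr pair; rewrite /GRing.scale /= -mulrDl addrC subrK mul1r.
Qed.

Lemma norm_coord_le b p (r : R) :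
  (`|p| <= r) = (`|coord b p| <= r) && (`|coord (~~ b) p| <= r).
Proof. by rewrite norm_pair_le; case: b; rewrite // andbC. Qed.

Lemma between_comb {a b c : R} : a <= c -> c <= b ->
  exists t, [/\ 0 <= t, t <= 1 & c = t * a + (1 - t) * b].
Proof.
move=> ac cb; have [ab|ba] := ltP a b; last by exists 0; split; lra.
have ab0 : 0 < b - a by rewrite subr_gt0.
pose t := (b - c) / (b - a).
have tE : t * (b - a) = b - c by rewrite divfK ?gt_eqF.
exists t; split; [|by rewrite ler_pdivrMr// mul1r lerB|lra].
by rewrite divr_ge0 ?subr_ge0 ?(ltW ab).
Qed.

Lemma convex_comb {A} {p q} {t : R} : convex_set A -> A p -> A q ->
  0 <= t -> t <= 1 -> A (t *: p + (1 - t) *: q).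
Proof.
move=> cA Ap Aq t0 t1.
by have := cA p q (Itv01 t0 t1) (mem_set Ap) (mem_set Aq); rewrite inE.
Qed.

Lemma norm_comb_le {p q} {a b t : R} : 0 <= t -> t <= 1 ->
  `|p| <= a -> `|q| <= b -> `|t *: p + (1 - t) *: q| <= t * a + (1 - t) * b.
Proof.
move=> t0 t1 pa qb; apply: (le_trans (ler_normD _ _)).
have t1' : 0 <= 1 - t by rewrite subr_ge0.
by rewrite !normrZ (ger0_norm t0) (ger0_norm t1') lerD// ler_wpM2l.
Qed.

Lemma convex_comb3 {A} {p q c} {t u v : R} : convex_set A ->
  A p -> A q -> A c -> 0 <= t -> 0 <= u -> 0 <= v -> t + u + v = 1 ->
  A (t *: p + u *: q + v *: c).
Proof.
move=> cA Ap Aq Ac t0 u0 v0 tuv.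
have [v1|v1] := eqVneq v 1.
  have [-> ->] : t = 0 /\ u = 0 by split; lra.
  by rewrite !scale0r !add0r v1 scale1r.
have tu0 : 0 < t + u.
  suff : v < 1 by lra.
  by rewrite lt_neqAle v1 /=; lra.
have tuN0 := lt0r_neq0 tu0.
have le1 : t / (t + u) <= 1 by rewrite ler_pdivrMr// mul1r; lra.
have := convex_comb cA (convex_comb cA Ap Aq (divr_ge0 t0 (ltW tu0)) le1) Ac
  (ltW tu0).
have -> : (t + u) *: (t / (t + u) *: p + (1 - t / (t + u)) *: q) =
  t *: p + u *: q.
  rewrite scalerDr !scalerA mulrBr mulr1 [(t + u) * _]mulrC divfK//.
  by rewrite addrAC subrr add0r.
have -> : 1 - (t + u) = v by lra.
by apply; lra.
Qed.

(** The corner of the square of radius [r] about [a] that faces the segment from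
    [a + (0, sg * s)] to [a + (tg * t, 0)] is in the triangle spanned by this
    segment and any point [c] of the square: the bound on [r] places the corner
    on the segment or on the same side of it as [a], and no point of the square
    exceeds the corner in the directions [tg] and [sg]. *)
Lemma corner_mem {A} {a c} {sg tg s t r : R} : convex_set A ->
  A (a + (0, sg * s)) -> A (a + (tg * t, 0)) -> A c ->
  sg ^+ 2 = 1 -> tg ^+ 2 = 1 -> 0 < s -> 0 < t -> 0 <= r ->
  `|c - a| <= r -> r / s + r / t <= 1 -> A (a + r *: (tg, sg)).
Proof.
move=> cA As At Ac sg1 tg1 s0 t0 r0 ca rst.
set c1 := tg * (c - a).1; set c2 := sg * (c - a).2.
have sg_le (u v : R) : u ^+ 2 = 1 -> `|v| <= r -> u * v <= r.
  move=> /eqP; rewrite sqrf_eq1 ler_norml => /orP[]/eqP-> /andP[] ? ?; lra.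
have [c1r c2r] : c1 <= r /\ c2 <= r.
  by move: ca; rewrite norm_pair_le => /andP[h1 h2]; split; apply: sg_le.
pose m := 1 - r / s - r / t; pose k := 1 - c2 / s - c1 / t.
have m0 : 0 <= m by rewrite /m; lra.
have mk : m <= k.
  have : c2 / s <= r / s by rewrite ler_pM2r ?invr_gt0.
  have : c1 / t <= r / t by rewrite ler_pM2r ?invr_gt0.
  rewrite /m /k; lra.
(* The barycentric weight [v] of [c] makes the three weights sum to [1]; this
   reads [v * k = m]. *)
have [v [v0 v1 vk]] : exists v, [/\ 0 <= v, v <= 1 & v * k = m].
  have [k0|k0] := eqVneq k 0; first by exists 0; split => //; lra.
  have k_gt0 : 0 < k by rewrite lt_def k0 (le_trans m0 mk).
  exists (m / k); split; first by rewrite divr_ge0// ltW.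
    by rewrite ler_pdivrMr// mul1r.
  by rewrite divfK.
have vr (u : R) : u <= r -> 0 <= r - v * u.
  move=> ur; rewrite subr_ge0; have [u0|/ltW u0] := leP 0 u.
    by rewrite (le_trans _ ur)// ler_piMl.
  by rewrite (le_trans _ r0)// mulr_ge0_le0.
pose x := (r - v * c2) / s; pose y := (r - v * c1) / t.
have xs : x * s = r - v * c2 by rewrite divfK ?gt_eqF.
have yt : y * t = r - v * c1 by rewrite divfK ?gt_eqF.
have xyv : x + y + v = 1.
  have -> : x + y = r / s + r / t - v * (c2 / s + c1 / t).
    by rewrite /x /y; ring.
  by move: vk; rewrite /k /m; lra.
have x0 : 0 <= x by rewrite divr_ge0 ?vr// ltW.
have y0 : 0 <= y by rewrite divr_ge0 ?vr// ltW.
have := convex_comb3 cA As At Ac x0 y0 v0 xyv.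
have E1 : y * (tg * t) = tg * r - v * (c - a).1.
  rewrite mulrCA yt -[v * (c - a).1]mulr1 -tg1 /c1.
  by ring.
have E2 : x * (sg * s) = sg * r - v * (c - a).2.
  rewrite mulrCA xs -[v * (c - a).2]mulr1 -sg1 /c2.
  by ring.
have -> // : x *: (a + (0, sg * s)) + y *: (a + (tg * t, 0)) + v *: c =
    a + r *: (tg, sg).
rewrite [RHS]surjective_pairing [LHS]surjective_pairing /=.
have xE : x = 1 - y - v by lra.
rewrite xE in E2 *.
congr pair; rewrite /GRing.scale /=.
  by move: E1; rewrite /=; lra.
by move: E2; rewrite /=; lra.
Qed.

Lemma closed_approx {A} {p} : closed A ->
  (forall e, 0 < e -> exists2 q, A q & `|q - p| < e) -> A p.
Proof.
move=> /closure_id clA Ap; rewrite clA => B /nbhs_ballP[e /= e0 eB].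
have [q Aq qp] := Ap e e0; exists q; split => //; apply: eB.
by rewrite ball_prod_normE /ball_ /= distrC.
Qed.

End Plane.

(** * Lipschitz selections of intervals *)

(** [p j k] and [q k j] are points of the interval number [j], which is attached
    to the base point [e j]; the pair [p j k], [q j k] witnesses that the
    intervals [j] and [k] are close.  Finitely many witnesses attain their
    extrema, so [g (e j)] falls between two points of the interval itself, even
    when the interval is not closed. *)
Lemma lipschitz_between {R : realType} {T : Type} {J : finType}
    (d : T -> T -> R) (e : J -> T) (p q : J -> J -> R) :
  (forall x, d x x = 0) -> (forall x y, d x y = d y x) ->
  (forall x y z, d x y <= d x z + d z y) ->
  (forall j k, `|p j k - q j k| <= d (e j) (e k)) -> J ->
  exists g : T -> R,
    (forall x y, `|g x - g y| <= d x y) /\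
    (forall j, (exists k, p j k <= g (e j)) /\ exists k, g (e j) <= q k j).
Proof.
move=> d0 dC dT pq j0.
pose lo j := p j [arg min_(k < j0) p j k]%O.
have lo_le j k : lo j <= p j k by rewrite /lo; case: arg_minP => // i _; apply.
(* [g] is the largest lower envelope: the supremum of [lo j - d x (e j)]. *)
pose top x := [arg max_(j > j0) (lo j - d x (e j))]%O.
pose g x := lo (top x) - d x (e (top x)).
have g_ge x j : lo j - d x (e j) <= g x.
  by rewrite /g /top; case: arg_maxP => // i _; apply.
exists g; split=> [x y|j].
  have le x' y' : g x' <= g y' + d x' y'.
    have := g_ge y' (top x'); have := dT y' (e (top x')) x'.
    by rewrite (dC y' x') {2}/g; lra.
  by have := le x y; have := le y x; rewrite (dC y x) ler_norml; lra.
split.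
  exists [arg min_(k < j0) p j k]%O.
  by have := g_ge (e j) j; rewrite d0 subr0.
exists (top (e j)).
have := lo_le (top (e j)) j; have := pq (top (e j)) j.
by rewrite /g ler_norml (dC (e j)); lra.
Qed.

(** Over a one-point space, [lipschitz_between] produces a single number between
    points of each interval. *)
Lemma helly_intervals {R : realType} {J : finType} (I : J -> set R) :
  (forall j, is_interval (I j)) -> (forall j k, (I j `&` I k) !=set0) -> J ->
  exists h, forall j, I j h.
Proof.
move=> itvI meetI j0.
have [w wP] := choice (fun jk : J * J => meetI jk.1 jk.2).
pose W j k := w (j, k).
have [|||j k|g [_ gP]] := @lipschitz_between R unit J (fun _ _ => 0)
  (fun=> tt) W W _ _ _ _ j0; rewrite ?subrr ?normr0 ?addr0//.
exists (g tt) => j; have [[k wg] [k' gw]] := gP j.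
by apply: (itvI j _ _ (wP (j, k)).1 (wP (k', j)).2); rewrite wg gw.
Qed.

(** * Projection along the axes *)

Section AxisProjection.
Context {R : realType} {T : Type} (d : T -> T -> R) (F : T -> set (R * R))
  (g : T -> R * R).
Hypothesis d_refl : forall x, d x x = 0.
Hypothesis d_sym : forall x y, d x y = d y x.
Hypothesis d_tri : forall x y z, d x y <= d x z + d z y.
Hypothesis F_convex : forall x, convex_set (F x).
Hypothesis F_closed : forall x, closed (F x).
Hypothesis g_lip : forall x y, `|g x - g y| <= d x y.

Definition tripled x z : set (R * R) :=
  [set w | exists2 c, F z c & `|w - c| <= 3 * d x z].

(** [reach x] consists of the [r] for which every enlargement [F z + 3 d x z Q0]
    is at distance at most [r] from [g x], so its infimum is the supremum over
    [z] of these distances. *)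
Definition reach x : set R := [set r | 0 <= r /\
  forall z, exists2 c, F z c & `|c - g x| <= r + 3 * d x z].

Definition radius x : R := inf (reach x).

Lemma dist_ge0 x y : 0 <= d x y.
Proof. by have := d_tri x x y; rewrite d_refl (d_sym y x); lra. Qed.

Lemma radius_le x r : reach x r -> radius x <= r.
Proof. by move=> xr; apply: ge_inf => //; exists 0 => ? []. Qed.

Lemma radius_ge0 x : 0 <= radius x.
Proof.
rewrite /radius; have [->|/set0P ne] := eqVneq (reach x) set0.
  by rewrite inf0.
by apply: lb_le_inf => // r [].
Qed.

Lemma reach_lip {x y r} : reach x r -> reach y (r + 4 * d x y).
Proof.
move=> [r0 xr]; have := dist_ge0 x y; split; first by lra.
move=> z; have [c Fc cx] := xr z; exists c => //.
have -> : c - g y = (c - g x) + (g x - g y) by rewrite addrA subrK.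
apply: (le_trans (ler_normD _ _)).
have := g_lip x y; have := d_tri x z y; rewrite (d_sym y z); lra.
Qed.

Lemma radius_lip x y : reach x !=set0 ->
  radius y <= radius x + 4 * d x y.
Proof.
move=> ne; rewrite -lerBlDr; apply: lb_le_inf => // r /reach_lip yr.
by rewrite lerBlDr radius_le.
Qed.

(** For each [z], points of [F z] near [g x + t e] and near [g y + t' e] are
    combined with the weights for which [t e] and [t' e] cancel; what remains is
    [w] times a vector from [g x] to [g y], plus the errors [3 d y z] and
    [3 d x z] with weights [w] and [1 - w]. *)
Lemma reach_opposite {x y e} {t t' : R} : 0 < t -> t' < 0 ->
  (forall z, tripled x z (g x + t *: e)) ->
  (forall z, tripled y z (g y + t' *: e)) ->
  reach x (t / (t - t') * (4 * d x y)).
Proof.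
move=> t0 t'0 Hx Hy; have tt0 : 0 < t - t' by lra.
set w := t / (t - t').
have w0 : 0 <= w by rewrite divr_ge0// ltW.
have w1 : w <= 1 by rewrite ler_pdivrMr// mul1r; lra.
split; first by apply: mulr_ge0 => //; have := dist_ge0 x y; lra.
move=> z; have [q Fq qx] := Hx z; have [p Fp py] := Hy z.
exists (w *: p + (1 - w) *: q); first exact: convex_comb.
have wt : w * t' + (1 - w) * t = 0 by rewrite /w; field; rewrite gt_eqF.
have -> : w *: p + (1 - w) *: q - g x =
    - (w *: (g y + t' *: e - p) + (1 - w) *: (g x + t *: e - q)) -
    w *: (g x - g y).
  rewrite [LHS]surjective_pairing [RHS]surjective_pairing /=.
  by congr pair; rewrite /GRing.scale /=; [set E := e.1|set E := e.2];
    have := congr1 ( *%R^~ E) wt; rewrite mul0r; lra.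
apply: (le_trans (ler_normB _ _)); rewrite normrN.
have := norm_comb_le w0 w1 py qx.
rewrite normrZ ger0_norm//.
have : w * `|g x - g y| <= w * d x y by rewrite ler_wpM2l.
have : w * d y z <= w * (d x y + d x z).
  by rewrite ler_wpM2l// (d_sym x y) d_tri.
lra.
Qed.

(** The two bounds given by [reach_opposite] have complementary weights
    [t / (t - t')] and [- t' / (t - t')]. *)
Lemma radius_opposite {x y e} {t t' : R} : 0 < t -> t' < 0 ->
  (forall z, tripled x z (g x + t *: e)) ->
  (forall z, tripled y z (g y + t' *: e)) ->
  radius x + radius y <= 4 * d x y.
Proof.
move=> t0 t'0 Hx Hy.
have rx := radius_le _ _ (reach_opposite t0 t'0 Hx Hy).
have HyN z : tripled y z (g y + (- t') *: (- e)).
  by rewrite scaleNr scalerN opprK.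
have HxN z : tripled x z (g x + (- t) *: (- e)).
  by rewrite scaleNr scalerN opprK.
have [t'N tN] : 0 < - t' /\ - t < 0 by split; lra.
have ry := radius_le _ _ (reach_opposite t'N tN HyN HxN).
apply: (le_trans (lerD rx ry)); rewrite (d_sym y x) -mulrDl.
suff -> : t / (t - t') + - t' / (- t' - - t) = 1 by rewrite mul1r.
have -> : - t' - - t = t - t' by lra.
by rewrite -mulrDl divff// gt_eqF; lra.
Qed.

(** The radius is that of the square whose corner lies on the segment joining
    the two given points of the axes. *)
Lemma reach_axes {x} {s t : R} :
  (forall z, tripled x z (g x + (0, s))) ->
  (forall z, tripled x z (g x + (t, 0))) ->
  reach x (`|s| * `|t| / (`|s| + `|t|)).
Proof.
move=> Hs Ht; split; first by rewrite divr_ge0 ?mulr_ge0 ?addr_ge0.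
have [s0|s0] := eqVneq s 0.
  move=> z; have [p Fp] := Hs z; rewrite s0 => px; exists p => //.
  rewrite normr0 !mul0r add0r distrC -[g x]addr0.
  exact: px.
have [t0|t0] := eqVneq t 0.
  move=> z; have [q Fp] := Ht z; rewrite t0 => qx; exists q => //.
  rewrite normr0 mulr0 mul0r add0r distrC -[g x]addr0.
  exact: qx.
have ns : 0 < `|s| by rewrite normr_gt0.
have nt : 0 < `|t| by rewrite normr_gt0.
have nst : 0 < `|s| + `|t| by rewrite addr_gt0.
move=> z; have [p Fp px] := Hs z; have [q Fq qx] := Ht z.
pose w := `|t| / (`|s| + `|t|).
have w0 : 0 <= w by rewrite divr_ge0// ltW.
have w1 : w <= 1 by rewrite ler_pdivrMr// mul1r; lra.
exists (w *: p + (1 - w) *: q); first exact: convex_comb.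
have -> : w *: p + (1 - w) *: q - g x =
    ((1 - w) * t, w * s) -
    (w *: (g x + (0, s) - p) + (1 - w) *: (g x + (t, 0) - q)).
  rewrite [LHS]surjective_pairing [RHS]surjective_pairing /=.
  by congr pair; rewrite /GRing.scale /=; ring.
apply: (le_trans (ler_normB _ _)); apply: lerD; last first.
  by have := norm_comb_le w0 w1 px qx; lra.
rewrite norm_pair_le /= (normrM (1 - w)) (normrM w) (ger0_norm w0).
rewrite ger0_norm ?subr_ge0//.
have E1 : 1 - w = `|s| / (`|s| + `|t|) by rewrite /w; field; rewrite gt_eqF.
by rewrite E1 /w mulrAC lexx [`|t| / _ * _]mulrAC [`|t| * _]mulrC lexx.
Qed.

(** Every [r] of [reach x] slightly above the infimum provides a point of [F x]
    in the square of radius [r] about [g x], hence the corner of that square by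
    [corner_mem]; closedness gives the limit.  If the infimum is the bound of
    [reach_axes], the corner is on the segment between the two axis points. *)
Lemma axis_projection_mem {x} {s t : R} :
  (forall z, tripled x z (g x + (0, s))) ->
  (forall z, tripled x z (g x + (t, 0))) ->
  F x (g x + radius x *: (Num.sg t, Num.sg s)).
Proof.
move=> Hs Ht; have xr0 := reach_axes Hs Ht.
have tripled_id w : tripled x x w -> F x w.
  by move=> [c Fc]; rewrite d_refl mulr0 normr_le0 subr_eq0 => /eqP->.
have Fs := tripled_id _ (Hs x); have Ft := tripled_id _ (Ht x).
have rx0 : `|s| * `|t| / (`|s| + `|t|) = 0 -> radius x = 0.
  move=> r0; apply/eqP; rewrite eq_le radius_ge0 andbT -r0.
  exact: radius_le xr0.
have [s0|s0] := eqVneq s 0.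
  have -> : radius x = 0 by apply: rx0; rewrite s0 normr0 !mul0r.
  by rewrite scale0r; move: Fs; rewrite s0.
have [t0|t0] := eqVneq t 0.
  have -> : radius x = 0 by apply: rx0; rewrite t0 normr0 mulr0 mul0r.
  by rewrite scale0r; move: Ft; rewrite t0.
have ns : 0 < `|s| by rewrite normr_gt0.
have nt : 0 < `|t| by rewrite normr_gt0.
have nst : 0 < `|s| + `|t| by rewrite addr_gt0.
set r0 := _ / _ in xr0.
have r0E : r0 / `|s| + r0 / `|t| = 1.
  by rewrite /r0; field; rewrite !gt_eqF.
have corner c r : F x c -> 0 <= r -> `|c - g x| <= r ->
    r / `|s| + r / `|t| <= 1 -> F x (g x + r *: (Num.sg t, Num.sg s)).
  move=> Fc rge cr; apply: (corner_mem _ _ _ Fc) => //.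
  - by rewrite -numEsg.
  - by rewrite -numEsg.
  - by rewrite sqr_sg s0.
  - by rewrite sqr_sg t0.
have [rr|rr] := ltP (radius x) r0; last first.
  have -> : radius x = r0 by apply/eqP; rewrite eq_le rr radius_le.
  pose w := `|t| / (`|s| + `|t|).
  have w0 : 0 <= w by rewrite divr_ge0// ltW.
  have w1 : w <= 1 by rewrite ler_pdivrMr// mul1r; lra.
  have := convex_comb (F_convex x) Fs Ft w0 w1.
  congr (F x _).
  rewrite [LHS]surjective_pairing [RHS]surjective_pairing /=.
  have E1 : (1 - w) * t = r0 * Num.sg t.
    by rewrite {1}[t]numEsg /w /r0; field; rewrite gt_eqF.
  have E2 : w * s = r0 * Num.sg s.
    by rewrite {1}[s]numEsg /w /r0; field; rewrite gt_eqF.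
  by congr pair; rewrite /GRing.scale /= -?E1 -?E2; ring.
apply: (closed_approx (F_closed x)) => e e0.
have [||r xr rlt] := @inf_adherent R (reach x) (Num.min e (r0 - radius x)).
- by rewrite lt_min e0 subr_gt0.
- by split; [exists r0|exists 0 => ? []].
have [c Fc] := xr.2 x; rewrite d_refl mulr0 addr0 => cx.
have rad_r := radius_le _ _ xr.
have := rlt; rewrite -ltrBlDl lt_min => /andP[re rr0].
exists (g x + r *: (Num.sg t, Num.sg s)).
  apply: (corner _ _ Fc xr.1 cx); rewrite -r0E; apply: lerD;
    rewrite ler_pM2r ?invr_gt0//; move: rr0; rewrite /radius; lra.
rewrite opprD addrACA subrr add0r -scalerBl normrZ.
rewrite ger0_norm ?subr_ge0//; apply: le_lt_trans re; apply: ler_piMr.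
  by rewrite subr_ge0.
by rewrite norm_pair_le /= !normr_sg !lern1 !leq_b1.
Qed.

(** Signed radii along the axis of direction [e]: with equal signs this is
    [radius_lip], with opposite signs [radius_opposite], and a sign vanishes only
    where the radius does. *)
Lemma radius_sg_lip {x y e} {t t' : R} :
  reach x !=set0 -> reach y !=set0 ->
  (t = 0 -> radius x = 0) -> (t' = 0 -> radius y = 0) ->
  (forall z, tripled x z (g x + t *: e)) ->
  (forall z, tripled y z (g y + t' *: e)) ->
  `|radius x * Num.sg t - radius y * Num.sg t'| <= 4 * d x y.
Proof.
move=> nex ney tr t'r Hx Hy.
have rxy := radius_lip x y nex; have ryx := radius_lip y x ney.
have rx := radius_ge0 x; have ry := radius_ge0 y.
rewrite (d_sym y x) in ryx; rewrite ler_norml.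
have [t0|t0|t0] := ltgtP t 0; have [t'0|t'0|t'0] := ltgtP t' 0;
  rewrite ?(gtr0_sg t0) ?(ltr0_sg t0) ?(gtr0_sg t'0) ?(ltr0_sg t'0)
    ?t0 ?t'0 ?sgr0;
  (try by apply/andP; lra);
  (try have rx0 := tr t0); (try have ry0 := t'r t'0); try (by apply/andP; lra).
- have := radius_opposite t'0 t0 Hy Hx; rewrite (d_sym y x) => ?.
  by apply/andP; lra.
- by have := radius_opposite t0 t'0 Hx Hy => ?; apply/andP; lra.
Qed.

(** Each coordinate of [f] is a coordinate of [g], which contributes [d x y],
    plus a signed radius, which contributes [4 * d x y]. *)
Lemma axis_projection :
  (forall x, exists s, forall z, tripled x z (g x + (0, s))) ->
  (forall x, exists t, forall z, tripled x z (g x + (t, 0))) ->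
  exists f : T -> R * R,
    (forall x, F x (f x)) /\ forall x y, `|f x - f y| <= 5 * d x y.
Proof.
move=> /choice[s Hs] /choice[t Ht].
exists (fun x => g x + radius x *: (Num.sg (t x), Num.sg (s x))).
split=> [x|x y]; first exact: axis_projection_mem.
have r0 x' : reach x' (`|s x'| * `|t x'| / (`|s x'| + `|t x'|)).
  exact: reach_axes.
have ne x' : reach x' !=set0 by eexists; exact: r0.
have rs x' : s x' = 0 -> radius x' = 0.
  move=> s0; apply/eqP; rewrite eq_le radius_ge0 andbT.
  by have := radius_le _ _ (r0 x'); rewrite s0 normr0 !mul0r.
have rt x' : t x' = 0 -> radius x' = 0.
  move=> t0; apply/eqP; rewrite eq_le radius_ge0 andbT.
  by have := radius_le _ _ (r0 x'); rewrite t0 normr0 mulr0 !mul0r.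
have Hs' x' z : tripled x' z (g x' + s x' *: (0, 1)).
  suff -> : s x' *: (0, 1) = (0, s x') :> R * R by [].
  by congr pair; rewrite /GRing.scale /= ?mulr0 ?mulr1.
have Ht' x' z : tripled x' z (g x' + t x' *: (1, 0)).
  suff -> : t x' *: (1, 0) = (t x', 0) :> R * R by [].
  by congr pair; rewrite /GRing.scale /= ?mulr0 ?mulr1.
have S := radius_sg_lip (ne x) (ne y) (rs x) (rs y) (Hs' x) (Hs' y).
have S' := radius_sg_lip (ne x) (ne y) (rt x) (rt y) (Ht' x) (Ht' y).
have := g_lip x y; move: S S'.
rewrite !norm_pair_le !ler_norml /= /GRing.scale /=.
move=> /andP[? ?] /andP[? ?] /andP[/andP[? ?] /andP[? ?]].
by apply/andP; split; apply/andP; lra.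
Qed.

End AxisProjection.

(** * Finite spaces with finite distances *)

Section FiniteSelection.
Context {R : realType} {T : finType} (d : T -> T -> R) (F : T -> set (R * R)).
Hypothesis d_refl : forall x, d x x = 0.
Hypothesis d_sym : forall x y, d x y = d y x.
Hypothesis d_tri : forall x y z, d x y <= d x z + d z y.
Hypothesis F_convex : forall x, convex_set (F x).
Hypothesis F_closed : forall x, closed (F x).

Definition slice x x' : set (R * R) :=
  [set u | F x u /\ exists2 v, F x' v & `|u - v| <= d x x'].

Lemma convex_slice {x x' p q} {t : R} : slice x x' p -> slice x x' q ->
  0 <= t -> t <= 1 -> slice x x' (t *: p + (1 - t) *: q).
Proof.
move=> [Fp [v Fv pv]] [Fq [w Fw qw]] t0 t1; split; first exact: convex_comb.
exists (t *: v + (1 - t) *: w); first exact: convex_comb.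
rewrite opprD addrACA -!scalerBr; have := norm_comb_le t0 t1 pv qw; lra.
Qed.

Lemma slice_between {b x x' p q} {h : R} : slice x x' p -> slice x x' q ->
  coord b p <= h -> h <= coord b q -> exists2 u, slice x x' u & coord b u = h.
Proof.
move=> Sp Sq ph hq; have [t [t0 t1 ->]] := between_comb ph hq.
by exists (t *: p + (1 - t) *: q); [exact: convex_slice|exact: coord_comb].
Qed.

Definition slices_close := forall b x x' y y', exists u v,
  [/\ slice x x' u, slice y y' v & `|coord b u - coord b v| <= d x y].

Lemma slice_coordinate b : slices_close ->
  exists g : T -> R, (forall x y, `|g x - g y| <= d x y) /\
    forall x x', exists2 u, slice x x' u & coord b u = g x.
Proof.
move=> /(_ b) H; have [[x0]|noT] := pselect (inhabited T); last first.
  by exists (fun=> 0); split=> x; case: noT; exists.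
have [u0] := choice (fun jk : (T * T) * (T * T) =>
  H jk.1.1 jk.1.2 jk.2.1 jk.2.2) => /choice[v0 uv].
have [j k|g [glip gP]] := lipschitz_between (J := (T * T)%type) d fst
  (fun j k => coord b (u0 (j, k))) (fun j k => coord b (v0 (j, k)))
  d_refl d_sym d_tri _ (x0, x0).
  by have [] := uv (j, k).
exists g; split => // x x'; have [[k pg] [k' gq]] := gP (x, x').
have [Su _ _] := uv ((x, x'), k); have [_ Sv _] := uv (k', (x, x')).
exact: slice_between Su Sv pg gq.
Qed.

(** When [d x y <= d x z], a point [u] of [F y] within [d y z] of [F z] and on
    the line through [g y] moves to the line through [g x] at cost [d x y].  The
    moved point is within [d x y + d y z <= 2 * d x y + d x z <= 3 * d x z] of
    [F z]; this is where the factor [3] comes from. *)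
Lemma line_meets {b} {g : T -> R} : (forall x y, `|g x - g y| <= d x y) ->
  (forall x x', exists2 u, slice x x' u & coord b u = g x) ->
  forall x, exists k, forall z, tripled d F x z (point b (g x) k).
Proof.
move=> glip gS x.
apply: (helly_intervals (fun z => [set k | tripled d F x z (point b (g x) k)]));
  last exact: x.
- move=> z k1 k2 [c1 F1 kc1] [c2 F2 kc2] k /andP[/between_comb kk /kk].
  move=> [t [t0 t1 ->]]; exists (t *: c1 + (1 - t) *: c2).
    exact: convex_comb.
  rewrite point_comb opprD addrACA -!scalerBr.
  by have := norm_comb_le t0 t1 kc1 kc2; lra.
- move=> y z.
  wlog yz : y z / d x y <= d x z.
    move=> W; have [|/ltW] := leP (d x y) (d x z); first exact: W.
    by rewrite setIC; exact: W.
  have [u [Fu [v Fv uv]] ug] := gS y z.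
  exists (coord (~~ b) u).
  have near : `|point b (g x) (coord (~~ b) u) - u| <= d x y.
    rewrite (norm_coord_le b) !coordB coord_point coordN_point ug glip /=.
    by rewrite subrr normr0 (dist_ge0 d).
  have dxy0 := dist_ge0 d d_refl d_sym d_tri x y.
  split; [exists u => //; lra|exists v => //].
  rewrite -(subrKA u); apply: (le_trans (ler_normD _ _)).
  by have := d_tri y z x; rewrite (d_sym y x); lra.
Qed.

Lemma finite_selection : slices_close ->
  exists f : T -> R * R,
    (forall x, F x (f x)) /\ forall x y, `|f x - f y| <= 5 * d x y.
Proof.
move=> H.
have [g1 [lip1 S1]] := slice_coordinate false H.
have [g2 [lip2 S2]] := slice_coordinate true H.
apply: (axis_projection d F (fun x => (g1 x, g2 x))) => //.
- by move=> x y; rewrite norm_pair_le lip1 lip2.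
- move=> x; have [k kP] := line_meets lip1 S1 x; exists (k - g2 x) => z.
  by move: (kP z); congr (tripled _ _ _ _ _); congr pair => /=; lra.
- move=> x; have [k kP] := line_meets lip2 S2 x; exists (k - g1 x) => z.
  by move: (kP z); congr (tripled _ _ _ _ _); congr pair => /=; lra.
Qed.

End FiniteSelection.

(** * Extended distances *)

Section ExtendedDistances.
Context {R : realType}.
Local Open Scope ereal_scope.

Lemma dilQ0P (r : \bar R) (w : R * R) : 0 <= r -> dilQ0 r w <-> `|w|%:E <= r.
Proof.
move: r => [r| |]// r0; last by split => // _; rewrite leey.
rewrite lee_fin in r0.
rewrite /dilQ0 lee_fin; split=> [[z [/= z1 z2] <-]|wr].
  rewrite normrZ (ger0_norm r0) ler_piMr// norm_pair_le !ler_norml.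
  by move: z1 z2; rewrite !in_itv /= => -> ->.
have [r00|r00] := eqVneq r 0%R.
  exists 0%R; first by split => /=; rewrite in_itv /=; apply/andP; split; lra.
  by move: wr; rewrite r00 normr_le0 => /eqP ->; rewrite scaler0.
have rp : (0 < r)%R by rewrite lt_def r00.
exists (r^-1 *: w); last by rewrite scalerA divff// scale1r.
have : (`|r^-1 *: w| <= 1)%R.
  by rewrite normrZ ger0_norm ?invr_ge0// mulrC ler_pdivrMr// mul1r.
by rewrite norm_pair_le !ler_norml /Q0 => /andP[h1 h2]; split;
  rewrite /= in_itv.
Qed.

Lemma minkowski_ballP {A : set (R * R)} {r : \bar R} {p} : 0 <= r ->
  minkowski_sum A (dilQ0 r) p <-> exists2 a, A a & `|p - a|%:E <= r.
Proof.
move=> r0; split=> [[[a w] [/= Aa /dilQ0P wr] <-]|[a Aa pa]].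
  by exists a => //; rewrite addrAC subrr add0r wr.
by exists (a, (p - a)%R); [split => //; exact/dilQ0P|rewrite addrC subrK].
Qed.

Lemma norm_comb_lee {p q : R * R} {t : R} {r : \bar R} : (0 <= t)%R ->
  (t <= 1)%R -> `|p|%:E <= r -> `|q|%:E <= r ->
  `|t *: p + (1 - t) *: q|%R%:E <= r.
Proof.
move: r => [r| |] t0 t1; rewrite ?leey// !lee_fin => pr qr.
by have := norm_comb_le t0 t1 pr qr; lra.
Qed.

Lemma escale_ge0 {l : R} {r : \bar R} : (0 <= l)%R -> 0 <= r -> 0 <= escale l r.
Proof. by move: r => [r| |]//= l0; rewrite !lee_fin; exact: mulr_ge0. Qed.

Lemma pseudometric_escale {M : Type} {rho : M -> M -> \bar R} {l : R} :
  (0 <= l)%R -> pseudometric rho ->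
  pseudometric (fun x y => escale l (rho x y)).
Proof.
move=> l0 [ge0 refl sym tri]; split=> [x y|x|x y|x y z].
- exact: escale_ge0.
- by rewrite refl /= mulr0.
- by rewrite sym.
- have := tri x y z; have := ge0 x y; have := ge0 x z; have := ge0 z y.
  move: (rho x y) (rho x z) (rho z y) => [a| |] [b| |] [c| |] //= c0 b0 a0.
    by rewrite !lee_fin -mulrDr; exact: ler_wpM2l.
  all: by move=> _; exact: leey.
Qed.

Lemma escaleM (k l : R) (r : \bar R) : escale (k * l) r = escale k (escale l r).
Proof. by move: r => [r| |]//=; rewrite mulrA. Qed.

End ExtendedDistances.

Section Truncation.
Context {R : realType} {M : Type} (delta : M -> M -> \bar R) (c : R).
Hypothesis delta_pm : pseudometric delta.
Hypothesis c0 : 0 <= c.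

Definition trunc x y : R := fine (mine (delta x y) c%:E).

Lemma truncE x y : (trunc x y)%:E = mine (delta x y) c%:E.
Proof.
rewrite /trunc; case: delta_pm => /(_ x y) ge0 _ _ _; move: (delta x y) ge0.
by move=> [a| |]//= _; rewrite -?EFin_min // min_r ?leey.
Qed.

Lemma le_trunc x y r : (r <= trunc x y) = (r%:E <= delta x y)%E && (r <= c).
Proof. by rewrite -lee_fin truncE le_min. Qed.

Lemma trunc_refl x : trunc x x = 0.
Proof.
by case: delta_pm => _ refl _ _; rewrite /trunc refl -EFin_min /= min_l.
Qed.

Lemma trunc_sym x y : trunc x y = trunc y x.
Proof. by case: delta_pm => _ _ sym _; rewrite /trunc sym. Qed.

Lemma trunc_tri x y z : trunc x y <= trunc x z + trunc z y.
Proof.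
rewrite -lee_fin EFinD !truncE; case: delta_pm => ge0 _ _ tri.
have := tri x y z; have := ge0 x z; have := ge0 z y.
have c0' : (0 <= c%:E)%E by rewrite lee_fin.
move: (delta x y) (delta x z) (delta z y) => r s t t0 s0 rst.
have [sc|sc] := leP s c%:E; last by rewrite ge_min leeDl ?orbT// le_min t0.
have [tc|tc] := leP t c%:E; last by rewrite ge_min leeDr ?orbT.
by rewrite ge_min rst.
Qed.

End Truncation.

(** * From the criterion to selections on finite families *)

Section FiniteFamilies.
Context {R : realType} {M : Type} {rho : M -> M -> \bar R}
  {F : M -> set (R * R)} {l : R}.
Hypothesis rho_pm : pseudometric rho.
Hypothesis F_Conv : forall x, Conv (F x).
Hypothesis l0 : 0 <= l.

Let delta x y := escale l (rho x y).
Let delta_pm : pseudometric delta := pseudometric_escale l0 rho_pm.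

(** The set whose rectangular hull is [rectF rho F l x x']. *)
Definition eslice x x' : set (R * R) :=
  [set u | F x u /\ exists2 v, F x' v & (`|u - v|%:E <= delta x x')%E].

Lemma esliceE x x' :
  F x `&` minkowski_sum (F x') (dilQ0 (delta x x')) = eslice x x'.
Proof.
case: delta_pm => ge0 _ _ _.
by apply/seteqP; split=> u [Fu /(minkowski_ballP (ge0 _ _)) ?].
Qed.

Lemma convex_eslice x x' : convex_set (eslice x x').
Proof.
have [_ cF _] := F_Conv x; have [_ cF' _] := F_Conv x'.
move=> p q t; rewrite !inE => -[Fp [v Fv pv]] [Fq [w Fw qw]].
have t0 : 0 <= t%:num by []; have t1 : t%:num <= 1 by [].
split; first exact: convex_comb.
exists (t%:num *: v + (1 - t%:num) *: w); first exact: convex_comb.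
rewrite [X in X - _](_ : _ = t%:num *: p + (1 - t%:num) *: q)//.
by rewrite opprD addrACA -!scalerBr; exact: norm_comb_lee.
Qed.

Lemma rectF_coord {x x' p} b : rectF rho F l x x' p ->
  exists2 u, eslice x x' u & coord b u = coord b p.
Proof.
rewrite /rectF -/(delta x x') esliceE rect_hullE; last exact: convex_eslice.
by move=> [[u Su up] [v Sv vp]]; case: b; [exists v|exists u].
Qed.

Lemma criterion_witnesses : rect_criterion rho F l -> forall b x x' y y',
  exists u v u' v', [/\ F x u, F x' v, F y u' & F y' v'] /\
    [/\ `|u - v|%:E <= delta x x', `|u' - v'|%:E <= delta y y' &
       `|coord b u - coord b u'|%:E <= delta x y]%E.
Proof.
move=> crit b x x' y y'; case: delta_pm => ge0 _ _ _.
have [p [Rp /(minkowski_ballP (ge0 _ _)) [q Rq pq]]] := crit x x' y y'.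
have [u [Fu [v Fv uv]] up] := rectF_coord b Rp.
have [u' [Fu' [v' Fv' uv']] uq] := rectF_coord b Rq.
exists u, v, u', v'; split; split => //.
rewrite up uq -coordB (le_trans _ pq)// lee_fin.
by have := lexx `|p - q|; rewrite {1}(norm_coord_le b) => /andP[].
Qed.

(** The family [e] need not be injective.  Truncating [delta] at a constant [c]
    above all the norms that occur in the chosen witnesses keeps these witnesses
    valid, and a bound by the truncated distance is also one by [delta]. *)
Lemma finite_family_selection {T : finType} (e : T -> M) :
  rect_criterion rho F l -> exists f : T -> R * R,
    (forall i, F (e i) (f i)) /\
    forall i j, (`|f i - f j|%:E <= escale (5 * l) (rho (e i) (e j)))%E.
Proof.
move=> /criterion_witnesses crit.
have [u] := choice (fun i : bool * T * T * T * T =>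
  crit i.1.1.1.1 (e i.1.1.1.2) (e i.1.1.2) (e i.1.2) (e i.2)).
move=> /choice[v /choice[u' /choice[v' wP]]].
pose h i := `|u i - v i| + `|u' i - v' i| +
  `|coord i.1.1.1.1 (u i) - coord i.1.1.1.1 (u' i)|.
have h0 i : 0 <= h i by rewrite /h !addr_ge0.
pose c := \sum_i h i.
have hc i : h i <= c by rewrite /c (bigD1 i)//= lerDl sumr_ge0.
have c0 : 0 <= c by rewrite sumr_ge0.
pose d i j := trunc delta c (e i) (e j).
have F_convex i : convex_set (F (e i)) by case: (F_Conv (e i)).
have F_closed i : closed (F (e i)) by case: (F_Conv (e i)).
have [||||f [Ff fL]] :=
  @finite_selection R T d (F \o e) _ _ _ F_convex F_closed.
- by move=> i; exact: trunc_refl.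
- by move=> i j; exact: trunc_sym.
- by move=> i j k; exact: trunc_tri.
- move=> b x x' y y'; pose i := (b, x, x', y, y').
  have [[Fu Fv Fu' Fv'] [uv uv' uu']] := wP i.
  exists (u i), (u' i); have hi := hc i; rewrite /h /= in hi.
  have n1 : 0 <= `|u i - v i| by []; have n2 : 0 <= `|u' i - v' i| by [].
  have n3 : 0 <= `|coord b (u i) - coord b (u' i)| by [].
  split.
  + by split => //; exists (v i) => //; rewrite le_trunc// uv /=; lra.
  + by split => //; exists (v' i) => //; rewrite le_trunc// uv' /=; lra.
  + by rewrite le_trunc// uu' /=; lra.
exists f; split=> // i j; rewrite escaleM -/(delta _ _).
have : ((5 * d i j)%:E <= escale 5 (delta (e i) (e j)))%E.
  have : d i j <= d i j by []; rewrite {2}/d le_trunc// => /andP[+ _].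
  by move: (delta _ _) => [r| |]; rewrite ?leey//= !lee_fin; lra.
by apply: le_trans; rewrite lee_fin.
Qed.

End FiniteFamilies.

(** * Compactness *)

Section Compactness.
Context {R : realType}.

Lemma compact_ball (r : R) : compact [set p : R * R | `|p| <= r].
Proof.
have -> : [set p : R * R | `|p| <= r] = `[- r, r] `*` `[- r, r].
  apply/seteqP; split=> p; rewrite /= norm_pair_le !ler_norml !in_itv /=.
    by move=> /andP[].
  by move=> [-> ->].
by apply: compact_setX; exact: segment_compact.
Qed.

Lemma bounded_seq_cluster {u : nat -> R * R} {B : R} :
  (forall n, `|u n| <= B) ->
  exists q, forall e N, 0 < e -> exists n, (N <= n)%N /\ `|u n - q| < e.
Proof.
move=> uB.
have uK : (u @ \oo) [set p | `|p| <= B] by exact: (@filterE _ \oo).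
have [q [_ qc]] := compact_ball B _ _ uK; exists q => e N e0.
have uN : (u @ \oo) [set p | exists2 n, (N <= n)%N & u n = p].
  by apply: (filterS _ (nbhs_infty_ge N)) => n Nn; exists n.
have [_ [[n Nn <-] un]] := qc _ _ uN (nbhsx_ballx q e e0).
by exists n; split => //; move: un; rewrite ball_prod_normE /ball_ /= distrC.
Qed.

Lemma closed_dist_attained {A : set (R * R)} {p} {r : R} : closed A ->
  (forall e, 0 < e -> exists2 a, A a & `|p - a| <= r + e) ->
  exists2 a, A a & `|p - a| <= r.
Proof.
move=> clA H.
have eps0 n : 0 < n.+1%:R^-1 :> R by rewrite invr_gt0 ltr0n.
have H' n : exists a, A a /\ `|p - a| <= r + n.+1%:R^-1.
  by have [a Aa pa] := H _ (eps0 n); exists a.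
have [u uP] := choice H'.
have [n|q qP] := @bounded_seq_cluster u (`|p| + (r + 1)).
  have -> : u n = p - (p - u n) by rewrite opprB addrC subrK.
  apply: (le_trans (ler_normB _ _)); rewrite lerD2l.
  by rewrite (le_trans (uP n).2)// lerD2l invf_le1 ?ler1n ?ltr0n.
exists q.
  apply: (closed_approx clA) => e e0; have [n [_ un]] := qP e 0%N e0.
  by exists (u n) => //; have [] := uP n.
apply/ler_addgt0Pr => e e0; have e20 : 0 < e / 2 by lra.
have [N Ne] := ltr_add_invr (y := 0) e20.
have [n [Nn un]] := qP (e / 2) N e20.
have -> : p - q = (p - u n) + (u n - q) by rewrite addrA subrK.
apply: (le_trans (ler_normD _ _)); have := (uP n).2.
have : n.+1%:R^-1 <= N.+1%:R^-1 :> R by rewrite lef_pV2 ?posrE ?ltr0n// ler_nat.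
move: Ne; set i := n.+1%:R^-1; set j := N.+1%:R^-1; lra.
Qed.

(** If the intersection of the [b]-enlargements contained points [u n] with
    [`|u n - p0|] tending to infinity, the points [q n] of the segments from [p0]
    to [u n] at the fixed distance [L] from [p0] would lie in enlargements by
    amounts tending to at most [a].  A cluster point of [q] would be in the
    bounded intersection of the [a]-enlargements, but too far from [p0]. *)
Lemma bounded_enlargement {I : Type} {A : I -> set (R * R)} {a b N : R} {p0} :
  (forall k, convex_set (A k)) -> (forall k, closed (A k)) ->
  (forall k, exists2 v, A k v & `|p0 - v| <= a) ->
  (forall p, (forall k, exists2 v, A k v & `|p - v| <= a) -> `|p| <= N) ->
  exists B, forall p, (forall k, exists2 v, A k v & `|p - v| <= b) -> `|p| <= B.
Proof.
move=> cA clA Ap0 SN; apply: contrapT => noB.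
have far (C : R) : exists p, (forall k, exists2 v, A k v & `|p - v| <= b) /\
    C <= `|p - p0|.
  apply: contrapT => noC; apply: noB; exists (C + `|p0|) => p Ap.
  rewrite leNgt; apply/negP => pC; apply: noC; exists p; split => //.
  by have := lerB_dist p p0; lra.
pose L := N + `|p0| + 1.
have L0 : 0 < L by have := SN _ Ap0; have : 0 <= `|p0| by []; rewrite /L; lra.
have [u uP] := choice (fun n : nat => far (L * n.+1%:R)).
pose t n := L / `|u n - p0|.
have d0 n : 0 < `|u n - p0|.
  by apply: lt_le_trans (uP n).2; rewrite mulr_gt0 ?ltr0n.
have t0 n : 0 <= t n by rewrite divr_ge0 ?ltW.
have tn n : t n <= n.+1%:R^-1.
  rewrite ler_pdivrMr// -ler_pdivrMl ?invr_gt0 ?ltr0n// invrK mulrC.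
  exact: (uP n).2.
have t1 n : t n <= 1.
  by apply: (le_trans (tn n)); rewrite invf_le1 ?ler1n ?ltr0n.
pose q n := t n *: u n + (1 - t n) *: p0.
have qp n : q n - p0 = t n *: (u n - p0).
  rewrite /q [RHS]scalerBr scalerBl scale1r.
  by rewrite [p0 - _]addrC addrA addrK.
have qL n : `|q n - p0| = L.
  by rewrite qp normrZ ger0_norm// divfK// gt_eqF.
have [n|w wP] := @bounded_seq_cluster q (L + `|p0|).
  by have := lerB_dist (q n) p0; rewrite qL; lra.
have wN : `|w| <= N.
  apply: SN => k; apply: (closed_dist_attained (clA k)) => e e0.
  have e20 : 0 < e / 2 by lra.
  have b0 : 0 < 1 + `|b - a| by rewrite ltr_pwDl.
  have [m Nm] := ltr_add_invr (y := 0) (divr_gt0 e20 b0).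
  have [n [Nn un]] := wP (e / 2) m e20.
  have [v Av uv] := (uP n).1 k; have [v0 Av0 pv0] := Ap0 k.
  exists (t n *: v + (1 - t n) *: v0); first exact: convex_comb.
  have := norm_comb_le (t0 n) (t1 n) uv pv0.
  have -> : t n *: (u n - v) + (1 - t n) *: (p0 - v0) =
      q n - (t n *: v + (1 - t n) *: v0).
    by rewrite /q opprD addrACA -!scalerBr.
  rewrite -(subrKA (q n) w) => qv.
  apply: (le_trans (ler_normD _ _)); rewrite distrC.
  have : t n * (b - a) <= e / 2.
    have m0 : 0 < n.+1%:R^-1 :> R by rewrite invr_gt0 ltr0n.
    have mn : n.+1%:R^-1 <= m.+1%:R^-1 :> R.
      by rewrite lef_pV2 ?posrE ?ltr0n// ler_nat.
    apply: (@le_trans _ _ (t n * (1 + `|b - a|))).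
      by rewrite ler_wpM2l// (le_trans (ler_norm _))// lerDr.
    rewrite -ler_pdivlMr// (le_trans (tn n))// (le_trans mn)//.
    by rewrite -[leLHS]add0r ltW.
  lra.
have [n [_ un]] := wP 2^-1 0%N ltac:(lra).
have := qL n; have := ler_normD (q n - w) (w - p0); rewrite addrA subrK.
have := ler_normB w p0; rewrite /L; lra.
Qed.

End Compactness.

(** The maps that are good on a finite family [e] form a filter base in the
    product of the balls of radii [r x]: two families are joined by their
    disjoint sum.  A cluster point is a global selection, as membership in the
    closed [F x] and each Lipschitz bound involve at most two points. *)
Lemma selection_compactness {R : realType} {M : Type} {F : M -> set (R * R)}
    {r : M -> R} {delta : M -> M -> \bar R} :
  (forall x, closed (F x)) ->
  (forall (T : finType) (e : T -> M), exists f : T -> R * R,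
    [/\ forall i, `|f i| <= r (e i), forall i, F (e i) (f i) &
        forall i j, (`|f i - f j|%:E <= delta (e i) (e j))%E]) ->
  exists f : M -> R * R,
    (forall x, F x (f x)) /\ forall x y, (`|f x - f y|%:E <= delta x y)%E.
Proof.
move=> clF H.
pose I : eqType := {classic M}.
pose X := prod_topology (fun _ : I => (R * R)%type).
pose good (T : finType) (e : T -> M) : set X := [set f |
  [/\ forall x, `|f x| <= r x, forall i, F (e i) (f (e i)) &
        forall i j, (`|f (e i) - f (e j)|%:E <= delta (e i) (e j))%E]].
pose G : set_system X :=
  [set A | exists (T : finType) (e : T -> M), good T e `<=` A].
have FG : ProperFilter G.
  split.
    move=> [T [e /= G0]]; have [f0 [f0r Ff0 f0L]] := H T e.
    (* Outside the range of [e] the map is extended by [0], which is in the ball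
       of radius [r x] since that ball is non-empty. *)
    have pickP x : exists y, `|y| <= r x /\
        ((exists i, e i = x) -> exists2 i, e i = x & y = f0 i).
      have [[i <-]|no] := pselect (exists i, e i = x).
        by exists (f0 i); split=> // _; exists i.
      have [g [gr _ _]] := H unit (fun=> x).
      by exists 0; split; [rewrite normr0 (le_trans _ (gr tt))|].
    have [f fP] := choice pickP.
    have fe i : exists2 j, e j = e i & f (e i) = f0 j.
      by apply: (fP _).2; exists i.
    apply: (G0 f); split=> [x|i|i j]; first exact: (fP x).1.
      by have [j <- ->] := fe i.
    by have [i' <- ->] := fe i; have [j' <- ->] := fe j.
  split.
  - by exists void, (of_void M).
  - move=> A B [T [e eA]] [T' [e' eB]].
    exists (T + T')%type.
    exists (fun s => match s with inl i => e i | inr i => e' i end).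
    move=> f [fr fF fL]; split; [apply: eA|apply: eB]; split=> //.
    + by move=> i; exact: (fF (inl i)).
    + by move=> i j; exact: (fL (inl i) (inl j)).
    + by move=> i; exact: (fF (inr i)).
    + by move=> i j; exact: (fL (inr i) (inr j)).
  - by move=> A B AB [T [e eA]]; exists T, e; exact: subset_trans AB.
have cK := tychonoff (I := I) (T := fun=> (R * R)%type)
  (A := fun x => [set p | `|p| <= r x]) (fun x => compact_ball (r x)).
have GK : G [set f | forall i : I, `|f i| <= r i].
  by exists void, (of_void M) => f [].
have [f [_ fG]] := cK G FG GK.
have near (x y : M) (e : R) : 0 < e -> exists f', [/\ F x (f' x),
    (`|f' x - f' y|%:E <= delta x y)%E, `|f' x - f x| < e & `|f' y - f y| < e].
  move=> e0.
  have nb (z : I) : nbhs f (proj z @^-1` ball (f z) e).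
    by apply: proj_continuous; exact: nbhsx_ballx.
  have Gxy : G (good bool (fun b => if b then x else y))
    by exists bool, (fun b => if b then x else y).
  have [f' [[_ f'F f'L] [fx fy]]] := fG _ _ Gxy (filterI (nb x) (nb y)).
  exists f'; split; [exact: (f'F true)|exact: (f'L true false)| |].
    by move: fx; rewrite /proj /= ball_prod_normE /ball_ /= distrC.
  by move: fy; rewrite /proj /= ball_prod_normE /ball_ /= distrC.
exists f; split=> [x|x y].
  apply: (closed_approx (clF x)) => e e0.
  have [f' [Ff _ fx _]] := near x x e e0.
  by exists (f' x).
apply/lee_addgt0Pr => e e0; have e20 : 0 < e / 2 by lra.
have [f' [_ fd fx fy]] := near x y _ e20.
apply: le_trans (leeD fd (lexx e%:E)); rewrite -EFinD lee_fin.
have -> : f x - f y = (f' x - f' y) - ((f' x - f x) - (f' y - f y)).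
  rewrite [LHS]surjective_pairing [RHS]surjective_pairing /=.
  by congr pair; ring.
apply: (le_trans (ler_normB _ _)); rewrite lerD2l.
by apply: (le_trans (ler_normB _ _)); lra.
Qed.

(** * The criterion *)

Lemma selection_criterion {R : realType} {M : Type} {rho : M -> M -> \bar R}
    {F : M -> set (R * R)} {f : M -> R * R} {l : R} :
  pseudometric rho -> 0 <= l -> selection F f ->
  (forall x y, (`|f x - f y|%:E <= escale l (rho x y))%E) ->
  rect_criterion rho F l.
Proof.
move=> rho_pm l0 Ff fL; case: (pseudometric_escale l0 rho_pm) => ge0 _ _ _.
have fR x x' : rectF rho F l x x' (f x).
  move=> A [_ SA]; apply: SA; split; first exact: Ff.
  by apply/minkowski_ballP => //; exists (f x').
move=> x x' y y'; exists (f x); split=> //.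
by apply/minkowski_ballP => //; exists (f y).
Qed.

(** A [K]-Lipschitz selection defined at [z] and at the points [xbar k] has its
    value at [z] within [K * rho z (xbar k)] of [F (xbar k)].  These distances
    are finite, so [bounded_enlargement] bounds all such values at once. *)
Lemma anchored_radius {R : realType} {M : Type} {rho : M -> M -> \bar R}
    {F : M -> set (R * R)} (K : R) {z : M} {alpha : R} {m : nat}
    {xbar : 'I_m -> M} :
  pseudometric rho -> (forall x, Conv (F x)) -> 0 <= alpha ->
  (forall k, (rho z (xbar k) < +oo)%E) ->
  \bigcap_k minkowski_sum (F (xbar k)) (dilQ0 alpha%:E) !=set0 ->
  bounded_set (\bigcap_k minkowski_sum (F (xbar k)) (dilQ0 alpha%:E)) ->
  exists r, forall p, (forall k, exists2 v, F (xbar k) v &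
    (`|p - v|%:E <= escale K (rho z (xbar k)))%E) -> `|p| <= r.
Proof.
move=> rho_pm F_Conv a0 fin [p0 Sp0] /ex_strict_bound_gt0 [N _ SN].
have alphaE0 : (0 <= alpha%:E)%E by rewrite lee_fin.
pose s k := fine (rho z (xbar k)).
have sE k : rho z (xbar k) = (s k)%:E.
  by rewrite fineK// ge0_fin_numE//; case: rho_pm.
pose beta := \sum_k `|K * s k|.
have [k|k|k|p Ap|r rP] := @bounded_enlargement R 'I_m (fun k => F (xbar k))
  alpha beta N p0.
- by have [] := F_Conv (xbar k).
- by have [] := F_Conv (xbar k).
- by have /(minkowski_ballP alphaE0)[v Fv pv] := Sp0 k I; exists v.
- apply/ltW/SN => k _; apply/(minkowski_ballP alphaE0).
  by have [v Fv pv] := Ap k; exists v.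
exists r => p pP; apply: rP => k; have [v Fv] := pP k; rewrite sE lee_fin => pv.
exists v => //; apply: (le_trans pv); apply: (le_trans (ler_norm _)).
by rewrite /beta (bigD1 k)//= lerDl sumr_ge0.
Qed.

(** In the infinite case, a finite family is enlarged by the points attached to
    its members, so that the values of its selections are bounded independently
    of the family. *)
Lemma criterion_selection {R : realType} {M : Type} {rho : M -> M -> \bar R}
    {F : M -> set (R * R)} {l : R} :
  pseudometric rho -> (forall x, Conv (F x)) -> 0 <= l ->
  rect_criterion rho F l ->
  (finite_set [set: M] \/
   forall z : M, exists (alpha : R) (m : nat) (xbar : 'I_m -> M),
     [/\ 0 <= alpha,
         forall k, (rho z (xbar k) < +oo)%E,
         \bigcap_k minkowski_sum (F (xbar k)) (dilQ0 alpha%:E) !=set0 &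
         bounded_set
           (\bigcap_k minkowski_sum (F (xbar k)) (dilQ0 alpha%:E))]) ->
  exists f : M -> R * R, selection F f /\
    forall x y, (`|f x - f y|%:E <= escale (5 * l) (rho x y))%E.
Proof.
move=> rho_pm F_Conv l0 crit [Mfin|anchor].
  have /(@finite_seqP {classic M})[s sE] := Mfin.
  pose e (i : 'I_(size s)) : M := tnth (in_tuple s) i.
  have onto x : exists i, e i = x.
    have xs : x \in (in_tuple s : seq {classic M}).
      by have : [set: M] x by []; rewrite sE.
    by have /tnthP[i ->] := xs; exists i.
  have [idx idxE] := choice onto.
  have [f [Ff fL]] := finite_family_selection rho_pm F_Conv l0 e crit.
  exists (f \o idx); split=> [x|x y]; first by rewrite -{1}[x]idxE.
  by have := fL (idx x) (idx y); rewrite !idxE.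
have anchored z : exists w : R * {m & 'I_m -> M}, forall p,
    (forall k, exists2 v, F (projT2 w.2 k) v &
      (`|p - v|%:E <= escale (5 * l) (rho z (projT2 w.2 k)))%E) -> `|p| <= w.1.
  have [alpha [m [xbar [a0 fin ne bd]]]] := anchor z.
  have [r rP] := anchored_radius (5 * l) rho_pm F_Conv a0 fin ne bd.
  by exists (r, existT _ m xbar).
have [w wP] := choice anchored.
pose anchors z := projT2 (w z).2.
apply: (selection_compactness (r := fun z => (w z).1)) => [x|T e].
  by have [] := F_Conv x.
pose T' : finType := (T + {i : T & 'I_(projT1 (w (e i)).2)})%type.
pose e' (t : T') : M := match t with
  | inl i => e i | inr ik => anchors (e (tag ik)) (tagged ik) end.
have [f [Ff fL]] := finite_family_selection rho_pm F_Conv l0 e' crit.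
exists (f \o inl); split=> [i|i|i j].
- apply: wP => k.
  pose t : T' := inr (Tagged (fun i => 'I_(projT1 (w (e i)).2)) k).
  by exists (f t); [exact: (Ff t)|exact: (fL (inl i) t)].
- exact: (Ff (inl i)).
- exact: (fL (inl i) (inl j)).
Qed.

Theorem theorem1p10 (R : realType) (M : Type) (rho : M -> M -> \bar R)
    (F : M -> set (R * R)) :
  pseudometric rho ->
  (forall x : M, Conv (F x)) ->
  (finite_set [set: M] \/
   forall z : M, exists (alpha : R) (m : nat) (xbar : 'I_m -> M),
     [/\ 0 <= alpha,
         forall k, (rho z (xbar k) < +oo)%E,
         \bigcap_k minkowski_sum (F (xbar k)) (dilQ0 alpha%:E) !=set0 &
         bounded_set
           (\bigcap_k minkowski_sum (F (xbar k)) (dilQ0 alpha%:E))]) ->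
  ((exists f : M -> R * R, lipschitz_selection rho F f) <->
   (exists l : R, 0 <= l /\ rect_criterion rho F l)) /\
  (criterion_inf rho F <= selection_norm rho F)%E /\
  (selection_norm rho F <= 5%:E * criterion_inf rho F)%E.
Proof.
move=> rho_pm F_Conv M_small.
have suff_sel l : 0 <= l -> rect_criterion rho F l -> exists f : M -> R * R,
    selection F f /\ (lip_norm rho f <= (5 * l)%:E)%E.
  move=> l0 crit.
  have [f [Ff fL]] := criterion_selection rho_pm F_Conv l0 crit M_small.
  exists f; split=> //; apply: ereal_inf_lbound; exists (5 * l) => //.
  by split=> //; apply: mulr_ge0.
split; last split.
- split=> [[f [Ff fL]]|[l [l0 /(suff_sel l l0) [f [Ff fl]]]]]; last first.
    by exists f; split=> //; apply: (le_lt_trans fl); exact: ltry.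
  have [_ [l [l0 lf] <-] _] := ereal_inf_lt fL.
  by exists l; split=> //; exact: selection_criterion rho_pm l0 Ff lf.
- apply/ereal_infP => _ [f [Ff _] <-]; apply/ereal_infP => _ [l [l0 lf] <-].
  apply: ereal_inf_lbound; exists l => //; split=> //.
  exact: selection_criterion rho_pm l0 Ff lf.
- rewrite -lee_pdivrMl//; apply/ereal_infP => _ [l [l0 crit] <-].
  rewrite lee_pdivrMl//; have [f [Ff fl]] := suff_sel l l0 crit.
  apply: (le_trans _ fl); apply: ereal_inf_lbound; exists f => //; split=> //.
  exact: (le_lt_trans fl (ltry _)).
Qed.
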